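(* Let $J$ be finite, let $\mathcal{S}=(X,(\phi_j)_{j\in J},(q_j)_{j\in J})$ be a max-plus IFS where $q_j(x)=q_j$ does not depend on $x$, and consider the associated iterated fuzzy function system $\mathcal{Z_R}=(X,(\phi_j)_{j\in J},(\rho_j)_{j\in J})$, where $\rho_j(t)=e^{q_j}t$ for $t\in[0,1]$ (that is, $\rho_j(t)=\theta(q_j+\theta^{-1}(t))$ with the scale function $\theta:[-\infty,0]\to[0,1]$, $\theta(t)=e^t$). Then the unique fuzzy attractor $u$ of $\mathcal{Z_R}$ satisfies, for all $x\in X$, $$u(x)=\bigoplus_{(j_1,j_2,j_3,\dots)\in\pi^{-1}(x)}e^{q_{j_1}+q_{j_2}+q_{j_3}+\cdots}.$$
   Context: $\bigoplus$ denotes supremum and $\vee$ denotes maximum. In the displayed formula for $u$, $e^{-\infty}=0$ and the supremum over the empty set is $0$. A max-plus IFS (mpIFS) $(X,(\phi_j)_{j\in J},(q_j)_{j\in J})$ consists of compact metric spaces $(X,d_X)$, $(J,d_J)$, maps $\phi_j:X\to X$ and functions $q_j:X\to\mathbb{R}$ ($j\in J$) such that: there is $0<\gamma<1$ with $d_X(\phi_{j_1}(x_1),\phi_{j_2}(x_2))\le\gamma[d_J(j_1,j_2)+d_X(x_1,x_2)]$ for all $j_1,j_2\in J$, $x_1,x_2\in X$; there is $C>0$ with $|q_j(x_1)-q_j(x_2)|\le C\,d_X(x_1,x_2)$ for all $j,x_1,x_2$; $\bigoplus_{j\in J}q_j(x)=0$ for all $x\in X$; and $(j,x)\mapsto q_j(x)$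 is continuous on $J\times X$. The map $\pi:J^{\mathbb{N}}\to X$ sends $\omega=(j_1,j_2,\dots)$ to the unique point $\pi(\omega)\in X$ satisfying $\pi(\omega)=\lim_{n\to\infty}\phi_{j_1}\circ\cdots\circ\phi_{j_n}(x_n)$ for every sequence $(x_n)$ in $X$. A fuzzy subset of $X$ is a function $u:X\to[0,1]$. $\mathcal{F}_X^*$ is the set of fuzzy subsets $u$ that are normal ($u(x)=1$ for some $x$), upper semi-continuous and compactly supported ($\overline{\{x:u(x)>0\}}$ is compact). For $\phi:X\to X$ and a fuzzy set $u$, the fuzzy set $\phi(u)$ is $\phi(u)(x)=\sup_{y\in\phi^{-1}(x)}u(y)$ if $x\in\phi(X)$ and $\phi(u)(x)=0$ otherwise. The fuzzy Hutchinson-Barnsley operator $\mathcal{Z_R}:\mathcal{F}_X^*\to\mathcal{F}_X^*$ is $\mathcal{Z_R}(u)=\bigvee_{j\in J}\rho_j(\phi_j(u))$, where $\rho_j(\phi_j(u))$ is the composition $x\mapsto\rho_j(\phi_j(u)(x))$. The fuzzy attractor of $\mathcal{Z_R}$ is the unique $u\in\mathcal{F}_X^*$ with $\mathcal{Z_R}(u)=u$ (existence and uniqueness hold because the maps $\phi_j$ are contractions). *)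

(* Defs.v *)
From HB Require Import structures.
From mathcomp Require Import all_boot all_order all_algebra.
From mathcomp Require Import all_classical all_reals all_analysis.

Set Implicit Arguments.
Unset Strict Implicit.
Unset Printing Implicit Defensive.

Import Order.TTheory GRing.Theory Num.Theory.
Import numFieldNormedType.Exports.

Local Open Scope classical_set_scope.
Local Open Scope ring_scope.

Section definitions.
Context {R : realType} {X J : metricType R}.
Implicit Types (phi : J -> X -> X) (q : J -> X -> R) (w : nat -> J).
Implicit Types (u v : X -> R) (rho : J -> R -> R).

(* The normalization is stated with the supremum in the extended reals: the
   real-valued [sup] is 0 on empty and on unbounded sets. *)
Record max_plus_IFS phi q : Prop := {
  mpIFS_compactX : compact [set: X] ;
  mpIFS_compactJ : compact [set: J] ;
  mpIFS_contractive : exists2 gamma : R, 0 < gamma < 1 &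
    forall j1 j2 x1 x2, mdist (phi j1 x1) (phi j2 x2)
                        <= gamma * (mdist j1 j2 + mdist x1 x2) ;
  mpIFS_lipschitz : exists2 C : R, 0 < C &
    forall j x1 x2, `|q j x1 - q j x2| <= C * mdist x1 x2 ;
  mpIFS_normalized : forall x, ereal_sup [set (q j x)%:E | j in [set: J]] = 0%E ;
  mpIFS_continuous : continuous (fun jx : J * X => q jx.1 jx.2)
}.

(* phi_(w 0) (phi_(w 1) (... (phi_(w (n - 1)) x))); the sequence
   (j_1, j_2, ...) is represented by w with w k = j_(k+1). *)
Definition prefix_map phi w (n : nat) (x : X) : X :=
  foldr (fun k y => phi (w k) y) x (iota 0 n).

Definition is_coded_point phi w (x : X) : Prop :=
  forall y : nat -> X, prefix_map phi w n (y n) @[n --> \oo] --> x.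

(* The map pi. The value [x0] is returned only if no coded point exists, which
   never happens for a max-plus IFS; coded points are unique as X is Hausdorff. *)
Definition coding_map (x0 : X) phi w : X :=
  xget x0 [set x | is_coded_point phi w x].

Definition fuzzy_set u : Prop := forall x, 0 <= u x <= 1.

Definition upper_semicontinuous u : Prop :=
  forall x a, u x < a -> \forall y \near x, u y < a.

(* The class F_X^* *)
Record fuzzy_star u : Prop := {
  fuzzy_star_fuzzy : fuzzy_set u ;
  fuzzy_star_normal : exists x, u x = 1 ;
  fuzzy_star_usc : upper_semicontinuous u ;
  fuzzy_star_compact_support : compact (closure [set x | 0 < u x])
}.

Definition fuzzy_image (f : X -> X) u : X -> R := fun x =>
  if x \in range f then sup [set u y | y in f @^-1` [set x]] else 0.

(* For finite nonempty J the supremum is the maximum over j. *)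
Definition fuzzy_HB phi rho u : X -> R := fun x =>
  sup [set rho j (fuzzy_image (phi j) u x) | j in [set: J]].

Definition fuzzy_attractor (Z : (X -> R) -> (X -> R)) u : Prop :=
  [/\ fuzzy_star u, Z u = u & forall v, fuzzy_star v -> Z v = v -> v = u].

End definitions.

(* e^(q_(w 0) + q_(w 1) + ...): the series is summed in the extended reals;
   [expeR -oo = 0], so for nonpositive q the exponential is a real in [0, 1]. *)
Definition exp_series {R : realType} {J : Type} (q : J -> R) (w : nat -> J) : R :=
  fine (expeR (\sum_(0 <= k <oo) (q (w k))%:E)%E).

(* Main.v *)
Require Import Defs.
From HB Require Import structures.
From mathcomp Require Import all_boot all_order all_algebra.
From mathcomp Require Import all_classical all_reals all_analysis.
From mathcomp Require Import lra.

Set Implicit Arguments.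
Unset Strict Implicit.
Unset Printing Implicit Defensive.

Import Order.TTheory GRing.Theory Num.Theory.
Import numFieldNormedType.Exports.

Local Open Scope classical_set_scope.
Local Open Scope ring_scope.

(** For a fuzzy set v and a word s = j_1 ... j_n, the operator Z = fuzzy_HB
    satisfies
      e^(q_(j_1) + ... + q_(j_n)) v(y) <= Z^n(v)(phi_(j_1) ... phi_(j_n) y),
    and every nonnegative level strictly below a value of Z^n(v) is exceeded by
    such a left-hand side. The attractor is obtained by letting the words grow
    to infinite codes w; each comparison needs only one-sided information on the
    competitor.

    - If v is normal and upper semi-continuous with Z v <= v, start from y with
      v(y) = 1: the points phi_(w 0) ... phi_(w (n-1)) y tend to pi(w), and v is
      at least exp_series q w on all of them, so v(pi(w)) >= exp_series q w
      ([series_sup_le_supersolution]).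
    - If v <= Z v with v <= 1 and 0 <= a < v(x), unfolding this inequality
      repeatedly writes x as phi_(w 0) ... phi_(w (n-1)) y_n with
      a < e^(q_(w 0) + ... + q_(w (n-1))) v(y_n) for all n. Hence pi(w) = x and
      a <= exp_series q w ([subsolution_le_series_sup]).

    So the supremum u over codes is the only possible fixed point. It is one,
    because pi(j w) = phi_j(pi(w)) and
    exp_series q (j w) = e^(q_j) exp_series q w ([fuzzy_HB_series_sup]), and it
    is normal because some q_j is 0. The remaining point is upper semi-continuity
    ([series_sup_usc]), a Koenig-type argument over the finite alphabet: from
    codes of value at least b whose points approach x one extracts a single code
    w, each prefix of which is shared by codes of that kind with points
    arbitrarily close to x; then pi(w) = x and exp_series q w >= b.

    Throughout, exp_series q w is handled as the infimum of the weights of the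
    prefixes of w ([exp_series_geP]), and pi(w) as the point within gamma^n D of
    the image of the n-th prefix map for all n, where D bounds the diameter. *)

(** * Finite alphabets and infinite words *)

Lemma uniform_over_finite (R : realType) (J : choiceType) (P : J -> R -> Prop) :
  finite_set [set: J] ->
  (forall j e d, 0 < d <= e -> P j e -> P j d) ->
  (forall j, exists2 e, 0 < e & P j e) ->
  exists2 e, 0 < e & forall j, P j e.
Proof.
move=> /finite_seqP[s Js] Panti Pex.
suff [e e0 Pe] : exists2 e, 0 < e & forall j, j \in s -> P j e.
  by exists e => // j; apply: Pe; have : [set: J] j by []; rewrite Js.
elim: s {Js} => [|i s [e e0 IH]]; first by exists 1.
have [d d0 Pd] := Pex i.
have m0 : 0 < Num.min d e by rewrite lt_min d0.
exists (Num.min d e) => // j; rewrite in_cons => /orP[/eqP ->|/IH].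
  by apply: Panti Pd; rewrite m0 ge_min lexx.
by apply: Panti; rewrite m0 ge_min lexx orbT.
Qed.

(** Koenig's lemma in the form of dependent choice: a property of finite words
    that can always be maintained by appending a letter holds along all prefixes
    of one infinite word. *)
Lemma sequence_of_extendible_words {J : Type} (C : seq J -> Prop) :
  C [::] -> (forall s, C s -> exists j, C (rcons s j)) ->
  exists w : nat -> J, forall n, C (mkseq w n).
Proof.
move=> C0 CS; have [j0 _] := CS _ C0.
have [f Cf] : {f : seq J -> J & forall s, C s -> C (rcons s (f s))}.
  apply: (@choice _ _ (fun s j => C s -> C (rcons s j))) => s.
  by have [/CS[j]|] := pselect (C s); [exists j|exists j0].
pose s_ n := iter n (fun s => rcons s (f s)) [::].
exists (f \o s_) => n.
suff -> : mkseq (f \o s_) n = s_ n by elim: n => //= n; apply: Cf.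
by elim: n => // n IH; rewrite mkseqS IH.
Qed.

Lemma mkseq_recl {J : Type} (w : nat -> J) n :
  mkseq w n.+1 = w 0%N :: mkseq (w \o succn) n.
Proof. by rewrite /mkseq /= -[1%N]addn0 iotaDl -map_comp. Qed.

Lemma mkseqD {J : Type} (w : nat -> J) n m :
  mkseq w (n + m) = mkseq w n ++ mkseq (fun k => w (n + k)%N) m.
Proof. by rewrite /mkseq iotaD map_cat -[(0 + n)%N]addn0 iotaDl -map_comp. Qed.

Lemma prefix_mapE {R : realType} {X J : metricType R} (phi : J -> X -> X)
    w n x :
  prefix_map phi w n x = foldr phi x (mkseq w n).
Proof. by rewrite /prefix_map /mkseq foldr_map. Qed.

(** * Weights of words *)

Definition weight {R : realType} {J : Type} (q : J -> R) (s : seq J) : R :=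
  expR (\sum_(j <- s) q j).

Section weights.
Context {R : realType} {J : Type} (q : J -> R) (q_le0 : forall j, q j <= 0).

Lemma weight_nil : weight q [::] = 1.
Proof. by rewrite /weight big_nil expR0. Qed.

Lemma weight_cons j s : weight q (j :: s) = expR (q j) * weight q s.
Proof. by rewrite /weight big_cons expRD. Qed.

Lemma weight_rcons s j : weight q (rcons s j) = weight q s * expR (q j).
Proof. by rewrite /weight -cats1 big_cat big_seq1 expRD. Qed.

Lemma weight_le1 s : weight q s <= 1.
Proof. by rewrite /weight expR_le1; apply: sumr_le0 => j _. Qed.

(** The partial sums decrease, so exp_series q w is the infimum of the prefix
    weights. This universal property also covers a divergent sum, where the
    infimum is 0. *)
Lemma exp_series_geP b w :
  b <= exp_series q w <-> forall n, b <= weight q (mkseq w n).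
Proof.
(* For b <= 0 both sides hold; for b > 0 the comparison is made after taking
   logarithms, where it concerns limits of extended reals. *)
have [b_le0|b_gt0] := leP b 0.
  split=> [_ n|_]; apply: le_trans b_le0 _; first exact: expR_ge0.
  exact/fine_ge0/expeR_ge0.
pose S := (\sum_(0 <= k <oo) (q (w k))%:E)%E.
have qw_le0 k : (0 <= k)%N -> true -> ((q (w k))%:E <= 0)%E by rewrite lee_fin.
have S_le0 : (S <= 0)%E by apply: npeseries_le0.
have partialE n : (\sum_(0 <= k < n) (q (w k))%:E =
                   (\sum_(j <- mkseq w n) q j)%:E)%E.
  by rewrite sumEFin big_map /index_iota subn0.
have -> : (b <= exp_series q w) = ((ln b)%:E <= S)%E.
  rewrite -[RHS]lee_expeR /= lnK ?posrE// /exp_series -/S.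
  by case: S S_le0 => //= [r|]; rewrite ?lee_fin.
have weightE n : (b <= weight q (mkseq w n)) =
                 ((ln b)%:E <= \sum_(0 <= k < n) (q (w k))%:E)%E.
  by rewrite partialE lee_fin -[RHS]ler_expR lnK ?posrE.
split=> [bS n|bn].
  rewrite weightE; apply: le_trans bS _.
  apply: lime_le; first exact: is_cvg_npeseries.
  by exists n => // m /= nm; apply: lee_sum_npos_natr.
apply: lime_ge; first exact: is_cvg_npeseries.
by apply: nearW => n; rewrite -weightE.
Qed.

Lemma exp_series_le_weight w n : exp_series q w <= weight q (mkseq w n).
Proof. exact: (exp_series_geP _ _).1. Qed.

Lemma exp_series_ge0 w : 0 <= exp_series q w.
Proof. exact/fine_ge0/expeR_ge0. Qed.

Lemma exp_series_le1 w : exp_series q w <= 1.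
Proof. exact: le_trans (exp_series_le_weight w 0) (weight_le1 _). Qed.

Lemma exp_series_recl w :
  exp_series q w = expR (q (w 0%N)) * exp_series q (w \o succn).
Proof.
apply: le_anti; apply/andP; split.
  rewrite mulrC -ler_pdivrMr ?expR_gt0//; apply/exp_series_geP => n.
  rewrite ler_pdivrMr ?expR_gt0// mulrC -weight_cons -mkseq_recl.
  exact: exp_series_le_weight.
apply/exp_series_geP => -[|n].
  rewrite weight_nil -[1]mulr1; apply: ler_pM.
  - exact: expR_ge0.
  - exact: exp_series_ge0.
  - by rewrite expR_le1.
  - exact: exp_series_le1.
rewrite mkseq_recl weight_cons ler_wpM2l ?expR_ge0//.
exact: exp_series_le_weight.
Qed.

End weights.

(** * Real suprema of sets of nonnegative numbers

    Since the supremum of the empty set is 0, nonemptiness can be traded for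
    nonnegativity of the bound. *)

Section nonneg_sup.
Context {R : realType}.
Implicit Types (S : set R) (a : R).

Lemma sup_gt_ge0 S a : 0 <= a -> a < sup S -> exists2 b, S b & a < b.
Proof.
move=> a0 aS; apply: sup_gt => //; apply/set0P/eqP => S0.
by move: aS; rewrite S0 sup0 ltNge a0.
Qed.

Lemma sup_le_ge0 S a : 0 <= a -> ubound S a -> sup S <= a.
Proof.
move=> a0 Sa; rewrite leNgt; apply/negP => /(sup_gt_ge0 a0)[b /Sa].
by rewrite leNgt => /negP.
Qed.

Lemma sup_ge0 S : (forall a, S a -> 0 <= a) -> 0 <= sup S.
Proof.
move=> S0; have [->|/set0P[a Sa]] := eqVneq S set0; first by rewrite sup0.
have [bS|nbS] := pselect (has_ubound S).
  exact: le_trans (S0 _ Sa) (ub_le_sup bS Sa).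
by rewrite sup_out// => -[].
Qed.

End nonneg_sup.

(** * Sub- and supersolutions of the fuzzy Hutchinson-Barnsley equation *)

Section fuzzy_HB.
Context {R : realType} {X J : metricType R} (phi : J -> X -> X) (q : J -> R).
Hypothesis q_le0 : forall j, q j <= 0.

Local Notation Z := (fuzzy_HB phi (fun j t => expR (q j) * t)).

Lemma fuzzy_imageE (f : X -> X) (v : X -> R) x :
  fuzzy_image f v x = sup [set v y | y in f @^-1` [set x]].
Proof.
rewrite /fuzzy_image; case: ifPn => // /negP xf; rewrite -[LHS]sup0.
congr sup; apply/esym; rewrite -subset0 => t [y fy _].
by case: xf; apply/mem_set; exists y.
Qed.

(** The strict bound makes it unnecessary that the suprema in the operator be
    attained. *)
Lemma fuzzy_HB_gt v x a : 0 <= a -> a < Z v x ->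
  exists j y, phi j y = x /\ a < expR (q j) * v y.
Proof.
move=> a0 /(sup_gt_ge0 a0)[_ [j _ <-] aj]; exists j; move: aj.
have aq0 : 0 <= a / expR (q j) by rewrite divr_ge0 ?expR_ge0.
rewrite mulrC -ltr_pdivrMr ?expR_gt0// fuzzy_imageE.
move=> /(sup_gt_ge0 aq0)[_ [y yx <-]].
by rewrite ltr_pdivrMr ?expR_gt0// mulrC; exists y.
Qed.

Lemma fuzzy_HB_ge v j y : fuzzy_set v -> expR (q j) * v y <= Z v (phi j y).
Proof.
move=> v01; have image_le1 i x : fuzzy_image (phi i) v x <= 1.
  rewrite fuzzy_imageE; apply: sup_le_ge0 => // _ [z _ <-].
  by case/andP: (v01 z).
apply: (@le_trans _ _ (expR (q j) * fuzzy_image (phi j) v (phi j y))).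
  rewrite ler_wpM2l ?expR_ge0// fuzzy_imageE ub_le_sup//; last by exists y.
  by exists 1 => _ [z _ <-]; case/andP: (v01 z).
apply: ub_le_sup; last by exists j.
exists 1 => _ [i _ <-]; apply: (@le_trans _ _ (expR (q i) * 1)).
  by rewrite ler_wpM2l ?expR_ge0.
by rewrite mulr1 expR_le1.
Qed.

Lemma weight_le_supersolution v s y : fuzzy_set v -> (forall x, Z v x <= v x) ->
  weight q s * v y <= v (foldr phi y s).
Proof.
move=> v01 Zv; elim: s => [|j s IH] /=; first by rewrite weight_nil mul1r.
apply: le_trans _ (Zv _); apply: le_trans _ (fuzzy_HB_ge _ _ v01).
by rewrite weight_cons -mulrA ler_wpM2l ?expR_ge0.
Qed.

(** As a < weight q s * v y is strict and v y <= Z v y, the level a is still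
    exceeded after one more unfolding of Z, so the word can be extended
    forever. *)
Lemma subsolution_coding v x a : 0 <= a -> (forall y, v y <= Z v y) ->
  a < v x ->
  exists w, forall n, exists y,
    foldr phi y (mkseq w n) = x /\ a < weight q (mkseq w n) * v y.
Proof.
move=> a0 vZ avx.
pose C s := exists y, foldr phi y s = x /\ a < weight q s * v y.
suff [w Cw] : exists w, forall n, C (mkseq w n) by exists w.
apply: sequence_of_extendible_words.
  by exists x; rewrite weight_nil mul1r.
move=> s [y [sy]].
have as0 : 0 <= a / weight q s by rewrite divr_ge0 ?expR_ge0.
rewrite mulrC -ltr_pdivrMr ?expR_gt0// => /lt_le_trans/(_ (vZ y)).
move=> /(fuzzy_HB_gt as0)[j [z [jz]]]; rewrite ltr_pdivrMr ?expR_gt0// => az.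
exists j, z; rewrite foldr_rcons jz; split=> //.
by rewrite weight_rcons; lra.
Qed.

End fuzzy_HB.

(** * The coding map *)

Section coding_and_attractor.
Context {R : realType} {X J : metricType R} (x0 : X).
Context (phi : J -> X -> X) (gamma D : R).
Hypotheses (gamma01 : 0 < gamma < 1) (D_gt0 : 0 < D).
Hypothesis contr :
  forall j x y, mdist (phi j x) (phi j y) <= gamma * mdist x y.
Hypothesis diam : forall x y : X, mdist x y <= D.
Hypothesis compactX : compact [set: X].

Local Notation pi := (coding_map x0 phi).

Let gammaXD_gt0 n : 0 < gamma ^+ n * D.
Proof. by case/andP: gamma01 => g0 _; rewrite mulr_gt0// exprn_gt0. Qed.

Lemma mdist_foldr s x y :
  mdist (foldr phi x s) (foldr phi y s) <= gamma ^+ size s * D.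
Proof.
have [g0 _] := andP gamma01.
elim: s => [|j s IH] /=; first by rewrite expr0 mul1r.
by apply: le_trans (contr _ _ _) _; rewrite exprS -mulrA ler_wpM2l// ltW.
Qed.

Lemma geometric_small (c e : R) : 0 < e ->
  \forall n \near \oo, gamma ^+ n * c < e.
Proof.
move=> e0; have [g0 g1] := andP gamma01.
have gc : gamma ^+ n * c @[n --> \oo] --> (0 : R).
  rewrite -(mul0r c); apply: cvgM; last exact: cvg_cst.
  by apply: cvg_expr; rewrite ger0_norm// ltW.
near=> n; apply: le_lt_trans (ler_norm _) _.
by near: n; apply: cvgr0_norm_lt.
Unshelve. all: by end_near. Qed.

(** The choice of the inner point does not matter, since the n-th prefix map has
    an image of diameter at most gamma^n D. *)
Lemma is_coded_point_of_near w x :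
  (forall n, exists y, mdist x (foldr phi y (mkseq w n)) <= gamma ^+ n * D) ->
  is_coded_point phi w x.
Proof.
move=> xw y; apply/metricType_numDomainType.cvgrPdist_lt => e e0; near=> n.
have [z xz] := xw n; rewrite prefix_mapE.
apply: le_lt_trans (metric_triangle _ (foldr phi z (mkseq w n)) _) _.
apply: (@le_lt_trans _ _ (gamma ^+ n * (D + D))).
  by rewrite mulrDr lerD//; have := mdist_foldr (mkseq w n) z (y n);
    rewrite size_mkseq.
by near: n; apply: geometric_small.
Unshelve. all: by end_near. Qed.

(** A cluster point of the images of x0 is the limit: beyond rank n these images
    stay in the image of the n-th prefix map. *)
Lemma exists_coded_point w : exists x, is_coded_point phi w x.
Proof.
pose z n := foldr phi x0 (mkseq w n).
have [x [_ clx]] : [set: X] `&` cluster (z n @[n --> \oo]) !=set0.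
  by apply: compactX; apply: filterT.
exists x; apply: is_coded_point_of_near => n.
have tail : (z k @[k --> \oo]) (z @` [set m | (n <= m)%N]).
  by exists n => // m /= nm; exists m.
have near_x : nbhs x [set y | mdist x y < gamma ^+ n * D].
  by apply/metricType_numDomainType.nbhs_mdistP; exists (gamma ^+ n * D) => //=.
have [_ [[m nm <-] xm]] := clx _ _ tail near_x.
exists (foldr phi x0 (mkseq (fun k => w (n + k)%N) (m - n))).
by rewrite -foldr_cat -mkseqD subnKC// ltW.
Qed.

Lemma coding_map_coded w : is_coded_point phi w (pi w).
Proof. exact: xgetPex (exists_coded_point w). Qed.

Lemma coding_map_eq w x :
  (forall n, exists y, mdist x (foldr phi y (mkseq w n)) <= gamma ^+ n * D) ->
  pi w = x.
Proof.
move=> /is_coded_point_of_near xw.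
have cvg_pi := @coding_map_coded w (fun=> x0).
exact: (cvg_unique (@metric_hausdorff _ X) cvg_pi (xw (fun=> x0))).
Qed.

Lemma coding_map_near w n y :
  mdist (pi w) (foldr phi y (mkseq w n)) <= gamma ^+ n * D.
Proof.
apply/ler_addgt0Pr => e e0.
have /metricType_numDomainType.cvgrPdist_lt/(_ e e0) near_pi :=
  @coding_map_coded w (fun=> x0).
have [m [nm pi_m]] : exists m, (n <= m)%N /\
    mdist (pi w) (prefix_map phi w m x0) < e.
  near \oo => m; exists m; split; near: m; first exact: nbhs_infty_ge.
  exact: near_pi.
apply: le_trans (metric_triangle _ (prefix_map phi w m x0) _) _.
rewrite addrC; apply: lerD; last exact: ltW.
rewrite prefix_mapE -(subnKC nm) mkseqD foldr_cat.
by apply: le_trans (mdist_foldr _ _ _) _; rewrite size_mkseq.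
Unshelve. all: by end_near. Qed.

Lemma coding_map_recl w :
  pi w = phi (w 0%N) (pi (w \o succn)).
Proof.
have [g0 _] := andP gamma01.
apply: coding_map_eq => -[|n]; exists x0; first by rewrite expr0 mul1r.
rewrite mkseq_recl /= exprS -mulrA; apply: le_trans (contr _ _ _) _.
by rewrite ler_wpM2l ?(ltW g0)// coding_map_near.
Qed.

Lemma coding_map_prefix w n :
  exists y, pi w = foldr phi y (mkseq w n).
Proof.
elim: n w => [|n IH] w; first by exists (pi w).
have [y wy] := IH (w \o succn).
by exists y; rewrite mkseq_recl /= -wy -coding_map_recl.
Qed.

(** * The supremum over codes is the attractor *)

Context (q : J -> R).
Hypothesis q_le0 : forall j, q j <= 0.

Local Notation Z := (fuzzy_HB phi (fun j t => expR (q j) * t)).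

Definition series_sup (x : X) : R :=
  sup [set exp_series q w | w in pi @^-1` [set x]].

Lemma series_sup_ge0 x : 0 <= series_sup x.
Proof. by apply: sup_ge0 => _ [w _ <-]; exact: exp_series_ge0. Qed.

Lemma series_sup_le x b : 0 <= b ->
  (forall w, pi w = x -> exp_series q w <= b) ->
  series_sup x <= b.
Proof. by move=> b0 wb; apply: sup_le_ge0 => // _ [w /wb + <-]. Qed.

Lemma series_sup_ge w : exp_series q w <= series_sup (pi w).
Proof.
apply: ub_le_sup; last by exists w.
by exists 1 => _ [w' _ <-]; exact: exp_series_le1.
Qed.

Lemma series_sup_fuzzy : fuzzy_set series_sup.
Proof.
move=> x; rewrite series_sup_ge0/=; apply: series_sup_le => // w _.
exact: exp_series_le1.
Qed.

Lemma fuzzy_HB_series_sup : Z series_sup = series_sup.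
Proof.
apply/funext => x; apply: le_anti; apply/andP; split; last first.
  apply: series_sup_le.
    apply: sup_ge0 => _ [j _ <-]; rewrite mulr_ge0 ?expR_ge0// fuzzy_imageE.
    by apply: sup_ge0 => _ [y _ <-]; exact: series_sup_ge0.
  move=> w <-; rewrite exp_series_recl// coding_map_recl.
  apply: le_trans _ (fuzzy_HB_ge phi q_le0 _ _ series_sup_fuzzy).
  by rewrite ler_wpM2l ?expR_ge0// series_sup_ge.
rewrite leNgt; apply/negP.
move=> /(fuzzy_HB_gt (series_sup_ge0 x))[j [y [<-]]].
rewrite ltNge => /negP; apply.
rewrite mulrC -ler_pdivlMr ?expR_gt0//.
apply: series_sup_le => [|w <-]; first by
  rewrite divr_ge0 ?series_sup_ge0 ?expR_ge0.
rewrite ler_pdivlMr ?expR_gt0// mulrC.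
pose jw := fun n => if n is m.+1 then w m else j.
suff <- : pi jw = phi j (pi w).
  by rewrite -[w]/(jw \o succn) -[j]/(jw 0%N) -exp_series_recl// series_sup_ge.
exact: coding_map_recl.
Qed.

Lemma subsolution_le_series_sup v : fuzzy_set v -> (forall y, v y <= Z v y) ->
  forall x, v x <= series_sup x.
Proof.
move=> v01 vZ x; rewrite leNgt; apply/negP => ux.
have [ua av] := midf_lt ux; set a := (_ / _) in ua av.
have [|w ww] := @subsolution_coding R X J phi q v x a _ vZ av.
  exact: le_trans (series_sup_ge0 x) (ltW ua).
have wx : pi w = x.
  apply: coding_map_eq => n; have [y [<- _]] := ww n; exists y.
  by rewrite mdistxx ltW.
move: ua; rewrite ltNge -wx => /negP; apply.
apply: le_trans _ (series_sup_ge w).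
apply/exp_series_geP => // n; have [y [_ /ltW ay]] := ww n.
apply: le_trans ay _; rewrite -[leRHS]mulr1 ler_wpM2l ?expR_ge0//.
by case/andP: (v01 y).
Qed.

Lemma series_sup_le_supersolution v : fuzzy_star v ->
  (forall y, Z v y <= v y) ->
  forall x, series_sup x <= v x.
Proof.
move=> [v01 [y vy] v_usc _] Zv x.
apply: series_sup_le => [|w wx]; first by case/andP: (v01 x).
rewrite leNgt; apply/negP => /v_usc; rewrite -wx => near_lt.
have /= [n _ /(_ n (leqnn n))/=] := @coding_map_coded w (fun=> y) _ near_lt.
rewrite prefix_mapE ltNge => /negP; apply.
apply: le_trans (exp_series_le_weight q_le0 w n) _.
by rewrite -[leLHS]mulr1 -vy weight_le_supersolution.
Qed.

(** Suppose u(x) < b < a while u >= a at points arbitrarily close to x. The empty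
    word then belongs to the set C of prefixes of codes that have value at least b
    and point arbitrarily close to x. Finiteness of J makes C extendible: if no
    letter extended s within C, one radius e would exclude all letters at
    once. *)
Lemma series_sup_usc : finite_set [set: J] -> upper_semicontinuous series_sup.
Proof.
move=> finJ x a uxa; apply: contrapT => not_near.
have [ub ba] := midf_lt uxa; set b := (_ / _) in ub ba.
pose C s := forall e, 0 < e -> exists w,
  [/\ mkseq w (size s) = s, mdist x (pi w) < e & b <= exp_series q w].
have [w Cw] : exists w, forall n, C (mkseq w n).
  apply: sequence_of_extendible_words => [e e0|s Cs].
    apply: contrapT => now; apply: not_near.
    apply/metricType_numDomainType.nbhs_mdistP; exists e => // y /= xy.
    rewrite ltNge; apply/negP => ay; apply: now.
    have [|_ [w wy <-] bw] := @sup_gt_ge0 _ _ b _ (lt_le_trans ba ay).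
      exact: le_trans (series_sup_ge0 x) (ltW ub).
    by exists w; rewrite wy; split=> //; exact: ltW.
  apply: contrapT => /forallNP noj.
  have [e e0 noe] : exists2 e, 0 < e & forall j, ~ exists w,
      [/\ mkseq w (size (rcons s j)) = rcons s j, mdist x (pi w) < e
        & b <= exp_series q w].
    apply: (@uniform_over_finite _ _ (fun j e => ~ exists w,
      [/\ mkseq w (size (rcons s j)) = rcons s j, mdist x (pi w) < e
        & b <= exp_series q w]) finJ).
      move=> j e d /andP[d0 de] now [w [sw xw bw]]; apply: now.
      by exists w; split=> //; exact: lt_le_trans xw de.
    move=> j; have /existsNP[e /not_implyP[e0 He]] := noj j.
    by exists e.
  have [w [sw xw bw]] := Cs e e0.
  by apply: (noe (w (size s))); exists w; rewrite size_rcons mkseqS sw.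
have wx : pi w = x.
  apply: coding_map_eq => n.
  have [w' [ww' xw' _]] := Cw n _ (gammaXD_gt0 n).
  have [y w'y] := coding_map_prefix w' n.
  by exists y; move: ww'; rewrite size_mkseq => <-; rewrite -w'y ltW.
have : b <= series_sup x.
  rewrite -wx; apply: le_trans _ (series_sup_ge w).
  apply/exp_series_geP => // n; have [w' [ww' _ bw']] := Cw n 1 ltr01.
  apply: le_trans bw' _; move: ww'; rewrite size_mkseq => <-.
  exact: exp_series_le_weight.
by rewrite leNgt ub.
Qed.

Lemma series_sup_normal j : q j = 0 -> series_sup (pi (fun=> j)) = 1.
Proof.
move=> qj; apply: le_anti; rewrite (andP (series_sup_fuzzy _)).2 /=.
apply: le_trans _ (series_sup_ge _); apply/exp_series_geP => // n.
rewrite /weight big_map big1 ?expR0// => i _; exact: qj.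
Qed.

Lemma series_sup_attractor : finite_set [set: J] -> (exists j, q j = 0) ->
  fuzzy_attractor Z series_sup.
Proof.
move=> finJ [j qj]; split.
- split; first exact: series_sup_fuzzy.
  + by exists (pi (fun=> j)); exact: series_sup_normal.
  + exact: series_sup_usc.
  + by apply: subclosed_compact compactX _ => //; exact: closed_closure.
- exact: fuzzy_HB_series_sup.
- move=> v v_star Zv; have [v01 _ _ _] := v_star; apply/funext => x.
  apply: le_anti; rewrite subsolution_le_series_sup
    ?series_sup_le_supersolution//.
  all: by move=> y; rewrite Zv.
Qed.

End coding_and_attractor.

(** * Compactness and normalization *)

Lemma compact_mdist_bounded {R : realType} {X : metricType R} (x0 : X) :
  compact [set: X] -> exists2 D, 0 < D & forall x y : X, mdist x y <= D.
Proof.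
move=> cX.
have cont : continuous (mdist x0 : X -> R^o).
  move=> y; apply/cvgrPdist_lt => e e0.
  apply/metricType_numDomainType.nbhs_mdistP.
  exists e => // z /= yz; apply: le_lt_trans yz.
  have := metric_triangle x0 y z; have := metric_triangle x0 z y.
  by rewrite (metric_sym z y) ler_norml; lra.
have [|c _ cmax] :=
    @compact_EVT_max X R _ [set: X] _ cX (continuous_subspaceT cont).
  by exists x0.
have c_bound x : mdist x0 x <= mdist x0 c by apply: cmax; rewrite inE.
exists (mdist x0 c + mdist x0 c + 1) => [|x y].
  by have := mdist_ge0 x0 c; lra.
apply: le_trans (metric_triangle _ x0 _) _; rewrite metric_sym.
by have := c_bound x; have := c_bound y; lra.
Qed.

Lemma finite_sup0_attained {R : realType} {J : choiceType} (q : J -> R) :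
  finite_set [set: J] -> ereal_sup [set (q j)%:E | j in [set: J]] = 0%E ->
  exists j, q j = 0.
Proof.
move=> finJ sup_q; apply: contrapT => /forallNP q0.
have q_le0 j : q j <= 0.
  by rewrite -lee_fin -[leRHS]sup_q; apply: ereal_sup_ubound; exists j.
(* Otherwise all q j would lie below a common negative bound. *)
have [e e0 qe] : exists2 e, 0 < e & forall j, q j <= - e.
  apply: (@uniform_over_finite _ _ (fun j e => q j <= - e)) => //.
    by move=> j e d /andP[_ de] /le_trans; apply; rewrite lerN2.
  move=> j; exists (- q j); last by rewrite opprK.
  by rewrite oppr_gt0 lt_neqAle q_le0 andbT; apply/eqP.
have : (0 <= (- e)%:E :> \bar R)%E.
  by rewrite -sup_q; apply: ge_ereal_sup => _ [j _ <-]; rewrite lee_fin.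
by rewrite lee_fin oppr_ge0 leNgt e0.
Qed.

(* [x0] expresses that X is nonempty; [sup] of the empty set of reals is 0. *)
Theorem proposition5p9 (R : realType) (X J : metricType R) (x0 : X)
    (phi : J -> X -> X) (q : J -> R)
    (finJ : finite_set [set: J])
    (mpIFS : max_plus_IFS phi (fun j (_ : X) => q j)) :
  exists u : X -> R,
    fuzzy_attractor (fuzzy_HB phi (fun j t => expR (q j) * t)) u /\
    forall x : X,
      u x = sup [set exp_series q w | w in coding_map x0 phi @^-1` [set x]].
Proof.
have [cX _ [gamma gamma01 contr] _ /(_ x0) sup_q _] := mpIFS.
have [D D0 diam] := compact_mdist_bounded x0 cX.
exists (series_sup x0 phi q); split=> //.
apply: (@series_sup_attractor _ _ _ x0 phi gamma D) => //.
- by move=> j x y; rewrite -[X in gamma * X]add0r -(mdistxx j).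
- move=> j; rewrite -lee_fin -[leRHS]sup_q.
  by apply: ereal_sup_ubound; exists j.
- exact: finite_sup0_attained finJ sup_q.
Qed.
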